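(* Let $(\Omega,E,L)$ be a homology localization triple on the category $\mathcal{G}_\Gamma$ of groups over a group $\Gamma$, and let $\{\pi^{(n)}\}$ be the associated local derived series of $\pi\in\mathcal{G}_\Gamma$. Then for any $\pi\to G$ in $\Omega$ and any ordinal $n$, the induced homomorphism $\pi/\pi^{(n)}\to G/G^{(n)}$ is injective. In particular, with $\widehat\pi=E(\pi)$, the map $\pi/\pi^{(n)}\to\widehat\pi/\widehat\pi^{(n)}$ is injective for every $\pi\in\mathcal{G}_\Gamma$.
   Context: $R$ is a finite cyclic ring $\mathbb{Z}/d\mathbb{Z}$ or a subring of $\mathbb{Q}$. Objects of $\mathcal{G}_\Gamma$ are groups $\pi$ with a homomorphism $\pi\to\Gamma$; morphisms are homomorphisms commuting with the maps to $\Gamma$. A morphism is 2-connected on $H_*(-;A)$ if it induces an isomorphism on $H_1(-;A)$ and an epimorphism on $H_2(-;A)$. Given a collection $\Omega$ of morphisms, an object $A$ is local with respect to $\Omega$ if for every $\pi\to G$ in $\Omega$, each morphism $\pi\to A$ extends uniquely along $\pi\to G$ to $G\to A$. A localization functor with respect to $\Omega$ is a functor $E$ to local objects with a natural transformation $G\to E(G)$ such that any morphism from $G$ to a local object factors uniquely through $G\to E(G)$. A homology localization triple $(\Omega,E,L)$ consists of a collection $\Omega$ of morphisms in $\mathcal{G}_\Gamma$, a functor $E$ on $\mathcal{G}_\Gamma$, and a localization functor $L$ for group rings, i.e. a functor assigning to $\pi\in\mathcal{G}_\Gamma$ a ring $L(\pi)$ with a natural ring homomorphism $R\pi\to L(\pi)$,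 such that: (1) $E$ is a localization functor on $\mathcal{G}_\Gamma$ with respect to $\Omega$; (2) $\pi\to E(\pi)$ is in $\Omega$ for any $\pi\in\mathcal{G}_\Gamma$; (3) every $\pi\to G$ in $\Omega$ is 2-connected on $H_*(-;\Lambda)$, where $\Lambda=L(G)$. The associated local derived series is defined, simultaneously for all $\pi\in\mathcal{G}_\Gamma$ and by transfinite induction, by $\pi^{(0)}=\ker\{\pi\to\Gamma\}$; $$\pi^{(n+1)}=\ker\Big\{\pi^{(n)}\to\frac{\pi^{(n)}}{[\pi^{(n)},\pi^{(n)}]}=H_1\big(\pi;\mathbb{Z}[\pi/\pi^{(n)}]\big)\to H_1(\pi;\Lambda_\pi)\Big\},\qquad \Lambda_\pi=L(\widehat\pi/\widehat\pi^{(n)}),$$ where the last map is induced by $\mathbb{Z}[\pi/\pi^{(n)}]\to R[\widehat\pi/\widehat\pi^{(n)}]\to\Lambda_\pi$; and $\pi^{(n)}=\bigcap_{k<n}\pi^{(k)}$ for limit ordinals $n$. *)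

(* Defs.v *)
From HB Require Import structures.
From mathcomp Require Import all_boot all_order all_algebra finmap.
From mathcomp Require Import boolp classical_sets wochoice monalg.

Set Implicit Arguments.
Unset Strict Implicit.
Unset Printing Implicit Defensive.

Import GRing.Theory.
Local Open Scope ring_scope.
Local Open Scope quotient_scope.

(* The additive map sending the formal sum of the [a *g k] to that of [h k a]. *)
Section LinearExtension.
Context (K : choiceType) (A V : zmodType) (h : K -> A -> V).

Definition mlift (c : {malg A[K]}) : V := \sum_(k <- msupp c) h k c@_k.

Hypothesis hB : forall k, {morph h k : a b / a - b}.

Let h0 k : h k 0 = 0. Proof. by rewrite -(subrr 0) hB subrr. Qed.

Lemma mliftEw (D : {fset K}) c :
  (msupp c `<=` D)%fset -> mlift c = \sum_(k <- D) h k c@_k.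
Proof.
move=> sD; rewrite /mlift (big_fset_incl _ sD) // => k _.
by move/mcoeff_outdom=> ->; rewrite h0.
Qed.

Lemma mliftU a k : mlift << a *g k >> = h k a.
Proof. by rewrite (mliftEw (msuppU_le)) big_seq_fset1 mcoeffUU. Qed.

Lemma mlift_is_zmod_morphism : {morph mlift : c d / c - d}.
Proof.
move=> c d; rewrite (mliftEw (msuppB_le c d)) (mliftEw (fsubsetUl (msupp c) (msupp d))).
rewrite (mliftEw (fsubsetUr (msupp c) (msupp d))) -sumrB.
by apply: eq_bigr => k _; rewrite mcoeffB hB.
Qed.

End LinearExtension.

Lemma malg_ext (K : choiceType) (A V : zmodType) (f g : {malg A[K]} -> V) :
  {morph f : c d / c - d} -> {morph g : c d / c - d} ->
  (forall a k, f << a *g k >> = g << a *g k >>) -> f =1 g.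
Proof.
move=> fB gB fg c.
pose f' := GRing.isZmodMorphism.Build _ _ f fB.
pose g' := GRing.isZmodMorphism.Build _ _ g gB.
pose F : {additive _ -> _} := HB.pack f f'.
pose G : {additive _ -> _} := HB.pack g g'.
rewrite -[f]/(F : _ -> _) -[g]/(G : _ -> _) [c]monalgE !raddf_sum.
by apply: eq_bigr => k _; exact: fg.
Qed.

Definition grpring (R : pzRingType) (G : groupType) : Type := {malg R[G]}.

Section GroupRing.
Context (R : pzRingType) (G : groupType).

HB.instance Definition _ := GRing.Zmodule.on (grpring R G).

Implicit Types x y z : grpring R G.

Definition grpring_mul x y : grpring R G :=
  mlift (fun g a => mlift (fun h b => << a * b *g (g * h)%g >>) y) x.

Definition grpring_of (g : G) : grpring R G := << 1 *g g >>.

Fact grpring_mulBr : forall x, {morph grpring_mul x : y z / y - z}.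
Proof.
move=> x y z; rewrite /grpring_mul /mlift -sumrB; apply: eq_bigr => g _.
by refine (@mlift_is_zmod_morphism G R (grpring _ _)
  (fun h b => << x@_g * b *g (g * h)%g >>) _ _ _) => h b c /=; rewrite mulrBr raddfB.
Qed.

Fact grpring_mulBl : forall y, {morph grpring_mul^~ y : x z / x - z}.
Proof.
move=> y x z; refine (@mlift_is_zmod_morphism G R (grpring _ _)
  (fun g a => mlift (fun h b => << a * b *g (g * h)%g >>) y) _ _ _) => g a b.
by rewrite /mlift -sumrB; apply: eq_bigr => h _; rewrite mulrBl raddfB.
Qed.

Fact grpring_mulUU a g b h :
  grpring_mul << a *g g >> << b *g h >> = << a * b *g (g * h)%g >>.
Proof.
rewrite /grpring_mul mliftU ?mliftU // => [k c d|k c d]; first by rewrite mulrBr raddfB.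
by rewrite /mlift -sumrB; apply: eq_bigr => l _; rewrite mulrBl raddfB.
Qed.

Fact grpring_mulA : associative grpring_mul.
Proof.
move=> x y z; move: z; apply: (malg_ext (f := fun z => grpring_mul x (grpring_mul y z))
  (g := fun z => grpring_mul (grpring_mul x y) z)).
- by move=> c d /=; rewrite !grpring_mulBr.
- by move=> c d /=; rewrite !grpring_mulBr.
move=> c k; move: y; apply: (malg_ext
  (f := fun y => grpring_mul x (grpring_mul y << c *g k >>))
  (g := fun y => grpring_mul (grpring_mul x y) << c *g k >>)).
- by move=> y y' /=; rewrite grpring_mulBl grpring_mulBr.
- by move=> y y' /=; rewrite grpring_mulBr grpring_mulBl.
move=> b h; move: x; apply: (malg_ext
  (f := fun x => grpring_mul x (grpring_mul << b *g h >> << c *g k >>))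
  (g := fun x => grpring_mul (grpring_mul x << b *g h >>) << c *g k >>)).
- by move=> y y' /=; rewrite grpring_mulBl.
- by move=> y y' /=; rewrite !grpring_mulBl.
by move=> a g; rewrite !grpring_mulUU mulrA mulgA.
Qed.

Fact grpring_mul1x : left_id (grpring_of 1%g) grpring_mul.
Proof.
apply: (malg_ext (f := grpring_mul (grpring_of 1%g)) (g := id)) => //.
  exact: grpring_mulBr.
by move=> a g; rewrite grpring_mulUU mul1r mul1g.
Qed.

Fact grpring_mulx1 : right_id (grpring_of 1%g) grpring_mul.
Proof.
apply: (malg_ext (f := grpring_mul^~ (grpring_of 1%g)) (g := id)) => //.
  exact: grpring_mulBl.
by move=> a g; rewrite grpring_mulUU mulr1 mulg1.
Qed.

Fact grpring_mulDl : left_distributive grpring_mul +%R.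
Proof.
move=> x y z; have M0 : grpring_mul 0 z = 0.
  by rewrite -[X in grpring_mul X](subrr 0) grpring_mulBl subrr.
by rewrite -{1}[y]opprK grpring_mulBl -[- y]sub0r grpring_mulBl M0 sub0r opprK.
Qed.

Fact grpring_mulDr : right_distributive grpring_mul +%R.
Proof.
move=> x y z; have M0 : grpring_mul x 0 = 0.
  by rewrite -[X in grpring_mul _ X](subrr 0) grpring_mulBr subrr.
by rewrite -{1}[z]opprK grpring_mulBr -[- z]sub0r grpring_mulBr M0 sub0r opprK.
Qed.

HB.instance Definition _ := GRing.Zmodule_isPzRing.Build (grpring R G)
  grpring_mulA grpring_mul1x grpring_mulx1 grpring_mulDl grpring_mulDr.

Lemma grpring_ofM g h : grpring_of (g * h)%g = grpring_of g * grpring_of h.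
Proof. by rewrite /GRing.mul /= grpring_mulUU mulr1. Qed.

Lemma grpring_of1 : grpring_of 1%g = 1.
Proof. by []. Qed.

End GroupRing.

Section GroupRingMap.
Context (R S : pzRingType) (G H : groupType).
Context (phi : {rmorphism R -> S}) (f : UMagmaMorphism.type G H).

Definition grpring_map (x : grpring R G) : grpring S H :=
  mlift (fun g a => << phi a *g f g >>) x.

Fact grpring_map_zmod : zmod_morphism grpring_map.
Proof.
move=> x y; refine (@mlift_is_zmod_morphism G R (grpring _ _)
  (fun g a => << phi a *g f g >>) _ _ _) => g a b.
by rewrite !raddfB.
Qed.

Fact grpring_mapU a g : grpring_map << a *g g >> = << phi a *g f g >>.
Proof. by rewrite /grpring_map mliftU // => k b c; rewrite !raddfB. Qed.

Fact grpring_map_monoid : monoid_morphism grpring_map.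
Proof.
split=> [|x y]; first by rewrite [LHS]grpring_mapU rmorph1 gmulf1.
move: y; apply: (malg_ext (f := fun y => grpring_map (x * y))
  (g := fun y => grpring_map x * grpring_map y)).
- by move=> c d /=; rewrite mulrBr grpring_map_zmod.
- by move=> c d /=; rewrite grpring_map_zmod mulrBr.
move=> b h; move: x; rewrite /=; apply: (@malg_ext G R (grpring _ _)
  (fun x : grpring R G => grpring_map (x * (<< b *g h >> : grpring R G)))
  (fun x : grpring R G => grpring_map x * grpring_map << b *g h >>)).
- by move=> c d /=; rewrite mulrBl grpring_map_zmod.
- by move=> c d /=; rewrite grpring_map_zmod mulrBl.
move=> a g; rewrite /GRing.mul /= !(grpring_mapU, grpring_mulUU).
by rewrite rmorphM gmulfM.
Qed.

HB.instance Definition _ := GRing.isZmodMorphism.Build _ _ grpring_map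
  grpring_map_zmod.
HB.instance Definition _ := GRing.isMonoidMorphism.Build _ _ grpring_map
  grpring_map_monoid.

Lemma grpring_map_of g : grpring_map (grpring_of R g) = grpring_of S (f g).
Proof. by rewrite grpring_mapU rmorph1. Qed.

End GroupRingMap.

(* Coefficients: a right Z[G]-module, as an abelian group with a right action of G by
   additive maps. *)
Record rmod (G : groupType) := RMod {
  rm_car :> zmodType;
  rm_act : rm_car -> G -> rm_car;
  rm_actB : forall g, {morph rm_act^~ g : a b / a - b};
  rm_act1 : forall a, rm_act a 1%g = a;
  rm_actM : forall a g h, rm_act a (g * h)%g = rm_act (rm_act a g) h }.

Section RModOfRing.
Context (G : groupType) (S : pzRingType) (rho : {rmorphism grpring int G -> S}).

Let act (a : S) (g : G) : S := a * rho (grpring_of int g).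

Fact ring_actB g : {morph act^~ g : a b / a - b}.
Proof. by move=> a b; rewrite /act mulrBl. Qed.

Fact ring_act1 a : act a 1%g = a.
Proof. by rewrite /act grpring_of1 rmorph1 mulr1. Qed.

Fact ring_actM a g h : act a (g * h)%g = act (act a g) h.
Proof. by rewrite /act grpring_ofM rmorphM mulrA. Qed.

Definition rmod_of_ring : rmod G := RMod ring_actB ring_act1 ring_actM.

End RModOfRing.

Section Restriction.
Context (G H : groupType) (f : UMagmaMorphism.type G H) (A : rmod H).

Let act (a : A) (g : G) : A := rm_act a (f g).

Fact res_actB g : {morph act^~ g : a b / a - b}.
Proof. by move=> a b; rewrite /act rm_actB. Qed.

Fact res_act1 a : act a 1%g = a.
Proof. by rewrite /act gmulf1 rm_act1. Qed.

Fact res_actM a g h : act a (g * h)%g = act (act a g) h.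
Proof. by rewrite /act gmulfM rm_actM. Qed.

Definition rmod_res : rmod G := RMod res_actB res_act1 res_actM.

End Restriction.

(* Maps of coefficients along a group homomorphism. *)
Record rmod_map (G H : groupType) (f : G -> H) (A : rmod G) (B : rmod H) := RModMap {
  rmm_fun :> {additive A -> B};
  rmm_act : forall a g, rmm_fun (rm_act a g) = rm_act (rmm_fun a) (f g) }.

Definition rmod_res_map (G H : groupType) (f : UMagmaMorphism.type G H)
    (A : rmod H) : rmod_map f (rmod_res f A) A :=
  @RModMap _ _ f (rmod_res f A) A idfun (fun _ _ => erefl).

(* U -> V -> W with zero composite, and its homology at V. *)
Record complex := Complex {
  cx_U : zmodType; cx_V : zmodType; cx_W : zmodType;
  cx_in : {additive cx_U -> cx_V};
  cx_out : {additive cx_V -> cx_W};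
  cx_out_in : forall u, cx_out (cx_in u) = 0 }.

Section Homology.
Context (C : complex).

Definition is_cycle : {pred cx_V C} := [pred v | cx_out C v == 0].

Fact is_cycle_zmod_closed : zmod_closed is_cycle.
Proof.
split=> [|u v]; rewrite !inE ?raddf0 // => /eqP u0 /eqP v0.
by rewrite raddfB u0 v0 subrr.
Qed.

HB.instance Definition _ := GRing.isZmodClosed.Build (cx_V C) is_cycle
  is_cycle_zmod_closed.

Record cycles := Cycle { cycle_val : cx_V C; cycleP : cycle_val \in is_cycle }.

HB.instance Definition _ := [isSub for cycle_val].
HB.instance Definition _ := [Choice of cycles by <:].
HB.instance Definition _ := [SubChoice_isSubZmodule of cycles by <:].

Definition is_boundary : {pred cycles} :=
  fun z => `[< exists u, cx_in C u = cycle_val z >].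

Fact is_boundary_zmod_closed : zmod_closed is_boundary.
Proof.
split=> [|y z]; first by apply/asboolP; exists 0; rewrite raddf0.
move=> /asboolP[u uy] /asboolP[v vz]; apply/asboolP; exists (u - v).
by rewrite raddfB uy vz -[RHS]/(val (y - z)) raddfB.
Qed.

HB.instance Definition _ := GRing.isZmodClosed.Build cycles is_boundary
  is_boundary_zmod_closed.

Definition homology := Quotient.quot is_boundary.
HB.instance Definition _ := GRing.Zmodule.on homology.
HB.instance Definition _ := EqQuotient.on homology.

Definition hclass (z : cycles) : homology := \pi_homology z.

Lemma hclassB : {morph hclass : y z / y - z}.
Proof. by move=> y z; rewrite /hclass raddfB. Qed.

Lemma hclass_eq y z :
  hclass y = hclass z <-> exists u, cx_in C u = cycle_val y - cycle_val z.
Proof.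
rewrite /hclass; split.
  move/eqP; rewrite -Quotient.idealrBE => /asboolP[u uE]; exists u.
  by rewrite uE -[LHS]/(val (y - z)) raddfB.
case=> u uE; apply/eqP; rewrite -Quotient.idealrBE; apply/asboolP; exists u.
by rewrite uE -[RHS]/(val (y - z)) raddfB.
Qed.

End Homology.

Record complex_map (C D : complex) := ComplexMap {
  cm_U : {additive cx_U C -> cx_U D};
  cm_V : {additive cx_V C -> cx_V D};
  cm_W : {additive cx_W C -> cx_W D};
  cm_in : forall u, cm_V (cx_in C u) = cx_in D (cm_U u);
  cm_out : forall v, cm_W (cx_out C v) = cx_out D (cm_V v) }.

Section HomologyMap.
Context (C D : complex) (f : complex_map C D).

Fact cycles_mapP (z : cycles C) : cm_V f (cycle_val z) \in @is_cycle D.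
Proof. by case: z => v /= /eqP vz; rewrite inE -(cm_out f) vz raddf0. Qed.

Definition cycles_map (z : cycles C) : cycles D := Cycle (cycles_mapP z).

Definition homology_map (h : homology C) : homology D :=
  hclass (cycles_map (repr h)).

Lemma homology_mapE z : homology_map (hclass z) = hclass (cycles_map z).
Proof.
apply/hclass_eq; have /hclass_eq[u uE] : hclass (repr (hclass z)) = hclass z.
  by rewrite /hclass reprK.
by exists (cm_U f u); rewrite -(cm_in f) uE raddfB.
Qed.

Fact homology_map_is_zmod_morphism : zmod_morphism homology_map.
Proof.
elim/quotW=> y; elim/quotW=> z.
rewrite -[\pi y]/(hclass y) -[\pi z]/(hclass z) -hclassB !homology_mapE -hclassB.
congr hclass; apply: val_inj; rewrite [RHS]raddfB /=.
by rewrite -[LHS]/(cm_V f (val (y - z))) !raddfB.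
Qed.

HB.instance Definition _ := GRing.isZmodMorphism.Build _ _ homology_map
  homology_map_is_zmod_morphism.

End HomologyMap.

Section MalgMap.
Context (K L : choiceType) (A B : zmodType) (f : K -> L) (phi : {additive A -> B}).

Definition malg_map : {malg A[K]} -> {malg B[L]} :=
  mlift (fun k a => << phi a *g f k >>).

Let hB k : {morph (fun a => << phi a *g f k >>) : a b / a - b}.
Proof. by move=> a b; rewrite !raddfB. Qed.

Fact malg_map_is_zmod_morphism : zmod_morphism malg_map.
Proof. exact: mlift_is_zmod_morphism hB. Qed.

HB.instance Definition _ := GRing.isZmodMorphism.Build _ _ malg_map
  malg_map_is_zmod_morphism.

Lemma malg_mapU a k : malg_map << a *g k >> = << phi a *g f k >>.
Proof. exact: mliftU hB a k. Qed.

End MalgMap.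

(* The inhomogeneous bar complex A (x)_{Z[G]} B_n = A (x) Z[G^n] in degrees at
   most 3: << a *g (g1, ..., gn) >> stands for a [g1|...|gn]. *)
Section BarComplex.
Context (G : groupType) (A : rmod G).

Let d1U (g : G) (a : A) : A := rm_act a g - a.
Let d2U (p : G * G) (a : A) : {malg A[G]} :=
  let: (g, h) := p in
  << rm_act a g *g h >> - << a *g (g * h)%g >> + << a *g g >>.
Let d3U (p : G * G * G) (a : A) : {malg A[(G * G)%type]} :=
  let: (g, h, k) := p in
  << rm_act a g *g (h, k) >> - << a *g ((g * h)%g, k) >>
  + << a *g (g, (h * k)%g) >> - << a *g (g, h) >>.

Definition bar_d1 : {malg A[G]} -> A := mlift d1U.
Definition bar_d2 : {malg A[(G * G)%type]} -> {malg A[G]} := mlift d2U.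
Definition bar_d3 : {malg A[(G * G * G)%type]} -> {malg A[(G * G)%type]} :=
  mlift d3U.

Let morphB_add (U V : zmodType) (f g : U -> V) : {morph f : a b / a - b} ->
  {morph g : a b / a - b} -> {morph (fun a => f a + g a) : a b / a - b}.
Proof. by move=> fB gB a b; rewrite fB gB addrACA -opprD. Qed.

Let morphB_opp (U V : zmodType) (f : U -> V) : {morph f : a b / a - b} ->
  {morph (fun a => - f a) : a b / a - b}.
Proof. by move=> fB a b; rewrite fB opprD. Qed.

Let morphB_U (K : choiceType) (k : K) :
  {morph (fun a : A => << a *g k >>) : a b / a - b}.
Proof. by move=> a b; rewrite raddfB. Qed.

Let morphB_actU (K : choiceType) (k : K) g :
  {morph (fun a : A => << rm_act a g *g k >>) : a b / a - b}.
Proof. by move=> a b; rewrite rm_actB raddfB. Qed.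

Let d1UB k : {morph d1U k : a b / a - b}.
Proof. by apply: morphB_add => [|a b]; [exact: rm_actB | rewrite opprD]. Qed.

Let d2UB k : {morph d2U k : a b / a - b}.
Proof.
case: k => g h; apply: morphB_add; last exact: morphB_U.
by apply: morphB_add; [exact: morphB_actU | exact/morphB_opp/morphB_U].
Qed.

Let d3UB k : {morph d3U k : a b / a - b}.
Proof.
case: k => -[g h] k; apply: morphB_add; last exact/morphB_opp/morphB_U.
apply: morphB_add; last exact: morphB_U.
by apply: morphB_add; [exact: morphB_actU | exact/morphB_opp/morphB_U].
Qed.

Lemma bar_d1U a g : bar_d1 << a *g g >> = rm_act a g - a.
Proof. exact: mliftU d1UB a g. Qed.

Lemma bar_d2U a g h : bar_d2 << a *g (g, h) >> =
  << rm_act a g *g h >> - << a *g (g * h)%g >> + << a *g g >>.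
Proof. exact: mliftU d2UB a (g, h). Qed.

Lemma bar_d3U a g h k : bar_d3 << a *g (g, h, k) >> =
  << rm_act a g *g (h, k) >> - << a *g ((g * h)%g, k) >>
  + << a *g (g, (h * k)%g) >> - << a *g (g, h) >>.
Proof. exact: mliftU d3UB a (g, h, k). Qed.

Fact bar_d1_is_zmod_morphism : zmod_morphism bar_d1.
Proof. exact: mlift_is_zmod_morphism d1UB. Qed.
Fact bar_d2_is_zmod_morphism : zmod_morphism bar_d2.
Proof. exact: mlift_is_zmod_morphism d2UB. Qed.
Fact bar_d3_is_zmod_morphism : zmod_morphism bar_d3.
Proof. exact: mlift_is_zmod_morphism d3UB. Qed.

HB.instance Definition _ := GRing.isZmodMorphism.Build _ _ bar_d1
  bar_d1_is_zmod_morphism.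
HB.instance Definition _ := GRing.isZmodMorphism.Build _ _ bar_d2
  bar_d2_is_zmod_morphism.
HB.instance Definition _ := GRing.isZmodMorphism.Build _ _ bar_d3
  bar_d3_is_zmod_morphism.

Fact bar_d1_d2 c : bar_d1 (bar_d2 c) = 0.
Proof.
move: c; apply: (malg_ext (f := fun c => bar_d1 (bar_d2 c)) (g := fun=> 0)).
- by move=> c d; rewrite !raddfB.
- by move=> c d; rewrite subrr.
move=> a [g h]; rewrite bar_d2U !raddfD raddfN /= !bar_d1U rm_actM.
rewrite !opprD !opprK (AC (2*2*2) ((1*3)*(2*5)*(4*6))) /=.
by rewrite !(subrr, addNr) !addr0.
Qed.

Fact bar_d2_d3 c : bar_d2 (bar_d3 c) = 0.
Proof.
move: c; apply: (malg_ext (f := fun c => bar_d2 (bar_d3 c)) (g := fun=> 0)).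
- by move=> c d; rewrite !raddfB.
- by move=> c d; rewrite subrr.
move=> a [[g h] k]; rewrite bar_d3U !(raddfD, raddfN) /= !bar_d2U rm_actM mulgA.
set x1 := << _ *g k >>; set x2 := << _ *g (h * k)%g >>; set x3 := << _ *g h >>.
set x4 := << _ *g (g * h * k)%g >>; set x5 := << _ *g (g * h)%g >>.
set x6 := << _ *g g >>.
rewrite !opprD !opprK (AC (3*3*3*3) ((1*4)*(2*7)*(3*10)*(5*8)*(6*11)*(9*12))) /=.
by rewrite !(subrr, addNr) !addr0.
Qed.

Definition bar_complex1 : complex := Complex bar_d1_d2.
Definition bar_complex2 : complex := Complex bar_d2_d3.

Definition H1 := homology bar_complex1.
Definition H2 := homology bar_complex2.

End BarComplex.

Section BarMap.
Context (G H : groupType) (f : UMagmaMorphism.type G H).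
Context (A : rmod G) (B : rmod H) (phi : rmod_map f A B).

Let f2 (p : G * G) : H * H := (f p.1, f p.2).
Let f3 (p : G * G * G) : H * H * H := (f2 p.1, f p.2).

Fact bar_map_d1 c : phi (bar_d1 c) = bar_d1 (malg_map f phi c).
Proof.
move: c; apply: (malg_ext (f := fun c => phi (bar_d1 c))
  (g := fun c => bar_d1 (malg_map f phi c))) => [c d|c d|a g].
- by rewrite !raddfB.
- by rewrite !raddfB.
by rewrite malg_mapU !bar_d1U raddfB rmm_act.
Qed.

Fact bar_map_d2 c : malg_map f phi (bar_d2 c) = bar_d2 (malg_map f2 phi c).
Proof.
move: c; apply: (malg_ext (f := fun c => malg_map f phi (bar_d2 c))
  (g := fun c => bar_d2 (malg_map f2 phi c))) => [c d|c d|a [g h]].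
- by rewrite !raddfB.
- by rewrite !raddfB.
by rewrite malg_mapU bar_d2U !(raddfD, raddfN) /= !malg_mapU bar_d2U rmm_act gmulfM.
Qed.

Fact bar_map_d3 c : malg_map f2 phi (bar_d3 c) = bar_d3 (malg_map f3 phi c).
Proof.
move: c; apply: (malg_ext (f := fun c => malg_map f2 phi (bar_d3 c))
  (g := fun c => bar_d3 (malg_map f3 phi c))) => [c d|c d|a [[g h] k]].
- by rewrite !raddfB.
- by rewrite !raddfB.
rewrite malg_mapU bar_d3U !(raddfD, raddfN) /= !malg_mapU bar_d3U rmm_act.
by rewrite /f2 /= !gmulfM.
Qed.

Definition bar_map1 : complex_map (bar_complex1 A) (bar_complex1 B) :=
  @ComplexMap (bar_complex1 A) (bar_complex1 B) (malg_map f2 phi)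
    (malg_map f phi) phi bar_map_d2 bar_map_d1.

Definition bar_map2 : complex_map (bar_complex2 A) (bar_complex2 B) :=
  @ComplexMap (bar_complex2 A) (bar_complex2 B) (malg_map f3 phi)
    (malg_map f2 phi) (malg_map f phi) bar_map_d3 bar_map_d2.

Definition H1_map : H1 A -> H1 B := homology_map bar_map1.
Definition H2_map : H2 A -> H2 B := homology_map bar_map2.

End BarMap.

(* homology maps are additive, so a bijective one is an isomorphism *)
Definition two_connected (G H : groupType) (f : UMagmaMorphism.type G H)
    (A : rmod H) : Prop :=
  bijective (H1_map (rmod_res_map f A)) /\
  forall y, exists x, H2_map (rmod_res_map f A) x = y.

Record groupOver (Gamma : groupType) := GroupOver {
  go_car :> groupType;
  go_str : UMagmaMorphism.type go_car Gamma }.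

Record homOver (Gamma : groupType) (P G : groupOver Gamma) := HomOver {
  ho_fun :> UMagmaMorphism.type P G;
  ho_str : forall x, go_str G (ho_fun x) = go_str P x }.

Section Category.
Context (Gamma : groupType).
Implicit Types P G H : groupOver Gamma.

Lemma homOver_eq P G (f g : homOver P G) : f =1 g -> f = g.
Proof.
case: f g => [[f [[m1] [m2]]] fs] [[g [[n1] [n2]]] gs] /= /funext fg.
move: m1 m2 fs n1 n2 gs; rewrite /= fg => m1 m2 fs n1 n2 gs.
by rewrite (Prop_irrelevance m1 n1) (Prop_irrelevance m2 n2) (Prop_irrelevance fs gs).
Qed.

Definition homOver_id P : homOver P P :=
  @HomOver _ P P (idfun : UMagmaMorphism.type P P) (fun=> erefl).

Fact homOver_comp_str P G H (g : homOver G H) (f : homOver P G) x :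
  go_str H ((g \o f) x) = go_str P x.
Proof. by rewrite /= !ho_str. Qed.

Definition homOver_comp P G H (g : homOver G H) (f : homOver P G) : homOver P H :=
  @HomOver _ P H (g \o f : UMagmaMorphism.type P H) (homOver_comp_str g f).

End Category.

Record normal_subgroup (G : groupType) := NormalSubgroup {
  ns_set :> G -> Prop;
  ns1 : ns_set 1%g;
  nsM : forall x y, ns_set x -> ns_set y -> ns_set (x * y)%g;
  nsV : forall x, ns_set x -> ns_set x^-1%g;
  nsJ : forall x y, ns_set x -> ns_set (x ^ y)%g }.

Section Quotient.
Context (G : groupType) (N : normal_subgroup G).
Local Open Scope group_scope.

Definition quo_rel : rel G := fun x y => `[< N (x^-1 * y) >].

Fact quo_rel_equiv : equiv_class_of quo_rel.
Proof.
split=> [x|x y|y x z].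
- by apply/asboolP; rewrite mulVg; exact: ns1.
- by apply/asboolP/asboolP => /nsV; rewrite invgM invgK.
- move=> /asboolP xy /asboolP yz; apply/asboolP.
  by have := nsM xy yz; rewrite mulgA mulgK.
Qed.

Canonical quo_equiv := EquivRelPack quo_rel_equiv.
Canonical quo_encModRel := defaultEncModRel quo_rel.

Definition quo_group := {eq_quot quo_rel}.
HB.instance Definition _ := EqQuotient.on quo_group.
HB.instance Definition _ := Choice.on quo_group.

Definition coset (x : G) : quo_group := \pi_quo_group x.

Lemma coset_eq x y : coset x = coset y <-> N (x^-1 * y).
Proof.
rewrite /coset; split=> [/eqP|xy]; first by rewrite piE => /asboolP.
by apply/eqP; rewrite piE; apply/asboolP.
Qed.

Lemma coset_repr (q : quo_group) : coset (repr q) = q.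
Proof. exact: reprK. Qed.

Definition quo_mul (p q : quo_group) : quo_group := coset (repr p * repr q).
Definition quo_inv (p : quo_group) : quo_group := coset (repr p)^-1.

Fact quo_mulE x y : quo_mul (coset x) (coset y) = coset (x * y).
Proof.
apply/coset_eq; have /coset_eq Nx := coset_repr (coset x).
have /coset_eq Ny := coset_repr (coset y).
set a := repr _ in Nx *; set b := repr _ in Ny *.
have := nsM (nsJ b Nx) Ny.
by rewrite /conjg invgM !mulgA mulgK.
Qed.

Fact quo_invE x : quo_inv (coset x) = coset x^-1.
Proof.
apply/coset_eq; have /coset_eq Nx := coset_repr (coset x).
set a := repr _ in Nx *; rewrite invgK.
by have := nsJ x^-1 (nsV Nx); rewrite /conjg invgM !invgK !mulgA mulgV mul1g.
Qed.

Fact quo_mulA : associative quo_mul.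
Proof.
move=> p q r; rewrite -[p]coset_repr -[q]coset_repr -[r]coset_repr.
by rewrite !quo_mulE mulgA.
Qed.

Fact quo_mul1 : left_id (coset 1) quo_mul.
Proof. by move=> p; rewrite -[p]coset_repr quo_mulE mul1g. Qed.

Fact quo_mulV : left_inverse (coset 1) quo_inv quo_mul.
Proof. by move=> p; rewrite -[p]coset_repr quo_invE quo_mulE mulVg. Qed.

Fact quo_mulr1 : right_id (coset 1) quo_mul.
Proof. by move=> p; rewrite -[p]coset_repr quo_mulE mulg1. Qed.

Fact quo_mulrV : right_inverse (coset 1) quo_inv quo_mul.
Proof. by move=> p; rewrite -[p]coset_repr quo_invE quo_mulE mulgV. Qed.

HB.instance Definition _ := isGroup.Build quo_group
  quo_mulA quo_mul1 quo_mulr1 quo_mulV quo_mulrV.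

Fact coset_monoid_morphism : monoid.monoid_morphism coset.
Proof. by split=> // x y; rewrite -quo_mulE. Qed.

HB.instance Definition _ := isUMagmaMorphism.Build G quo_group coset
  coset_monoid_morphism.

End Quotient.

Section QuotientMap.
Context (G H : groupType) (N : normal_subgroup G) (M : normal_subgroup H).
Context (f : UMagmaMorphism.type G H).

Definition quo_group_map (fNM : forall x, N x -> M (f x)) (q : quo_group N) :
  quo_group M := coset M (f (repr q)).

Lemma quo_group_mapE fNM x : quo_group_map fNM (coset N x) = coset M (f x).
Proof.
apply/coset_eq; rewrite -gmulfV -gmulfM; apply: fNM.
by apply/coset_eq; rewrite coset_repr.
Qed.

Fact quo_group_map_monoid fNM : monoid.monoid_morphism (quo_group_map fNM).
Proof.
split=> [|p q].
  by rewrite -[1%g in LHS]/(coset N 1%g) quo_group_mapE gmulf1.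
rewrite -[p]coset_repr -[q]coset_repr -[(_ * _)%g in LHS]gmulfM.
by rewrite !quo_group_mapE !gmulfM.
Qed.

HB.instance Definition _ fNM := isUMagmaMorphism.Build _ _ (quo_group_map fNM)
  (quo_group_map_monoid fNM).

End QuotientMap.

Definition morphism_class (Gamma : groupType) :=
  forall P G : groupOver Gamma, homOver P G -> Prop.

Definition is_local (Gamma : groupType) (Omega : morphism_class Gamma)
    (A : groupOver Gamma) : Prop :=
  forall (P G : groupOver Gamma) (f : homOver P G), Omega P G f ->
  forall u : homOver P A, exists! v : homOver G A, homOver_comp v f = u.

Record endofunctor (Gamma : groupType) := Endofunctor {
  ef_ob :> groupOver Gamma -> groupOver Gamma;
  ef_map : forall P G, homOver P G -> homOver (ef_ob P) (ef_ob G);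
  ef_id : forall P, ef_map (homOver_id P) = homOver_id (ef_ob P);
  ef_comp : forall P G H (g : homOver G H) (f : homOver P G),
    ef_map (homOver_comp g f) = homOver_comp (ef_map g) (ef_map f) }.

Record localization_functor (Gamma : groupType) (Omega : morphism_class Gamma) :=
  LocalizationFunctor {
  lf_functor :> endofunctor Gamma;
  lf_eta : forall P, homOver P (lf_functor P);
  lf_eta_natural : forall P G (f : homOver P G),
    homOver_comp (lf_eta G) f = homOver_comp (ef_map lf_functor f) (lf_eta P);
  lf_local : forall P, is_local Omega (lf_functor P);
  lf_universal : forall P A, is_local Omega A -> forall u : homOver P A,
    exists! v : homOver (lf_functor P) A, homOver_comp v (lf_eta P) = u }.

Record grpring_localization (R : pzRingType) (Gamma : groupType) :=
  GrpringLocalization {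
  gl_ob :> groupOver Gamma -> pzRingType;
  gl_map : forall P G, homOver P G -> {rmorphism gl_ob P -> gl_ob G};
  gl_id : forall P, gl_map (homOver_id P) =1 id;
  gl_comp : forall P G H (g : homOver G H) (f : homOver P G),
    gl_map (homOver_comp g f) =1 gl_map g \o gl_map f;
  gl_unit : forall P : groupOver Gamma, {rmorphism grpring R P -> gl_ob P};
  gl_natural : forall P G (f : homOver P G) x,
    gl_map f (gl_unit P x) = gl_unit G (grpring_map idfun f x) }.

(* Z[G] -> R[G] *)
Definition grpring_base (R : pzRingType) (G : groupType) :
    {rmorphism grpring int G -> grpring R G} :=
  grpring_map (intmul 1 : {rmorphism int -> R}) (idfun : UMagmaMorphism.type G G).

(* L(G) as a right Z[G]-module, through Z[G] -> R[G] -> L(G). *)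
Definition gl_module (R : pzRingType) (Gamma : groupType)
    (L : grpring_localization R Gamma) (G : groupOver Gamma) : rmod G :=
  rmod_of_ring (gl_unit L G \o grpring_base R G).

Record homology_localization_triple (R : pzRingType) (Gamma : groupType) :=
  HomologyLocalizationTriple {
  hl_Omega : morphism_class Gamma;
  hl_E : localization_functor hl_Omega;
  hl_L : grpring_localization R Gamma;
  hl_eta_in : forall P, hl_Omega (lf_eta hl_E P);
  hl_two_connected : forall P G (f : homOver P G), hl_Omega f ->
    two_connected f (gl_module hl_L G) }.

(* Normal subgroups N(P) <= ker (P -> Gamma), natural in P: exactly what is
   needed to form P / N(P) as a functor on groups over Gamma. *)
Record normal_subfunctor (Gamma : groupType) := NormalSubfunctor {
  nf_sub :> forall P : groupOver Gamma, normal_subgroup P;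
  nf_ker : forall P x, nf_sub P x -> go_str P x = 1%g;
  nf_map : forall P G (f : homOver P G) x, nf_sub P x -> nf_sub G (f x) }.

Section QuotientOver.
Context (Gamma : groupType) (N : normal_subfunctor Gamma).
Implicit Types P G : groupOver Gamma.

Definition quo_str P (q : quo_group (N P)) : Gamma := go_str P (repr q).

Fact quo_strE P x : quo_str (coset (N P) x) = go_str P x.
Proof.
rewrite /quo_str; apply/divg1_eq; rewrite -gmulfV -gmulfM.
set y := repr _.
suff : N P (y * x^-1)%g by exact: nf_ker.
have /coset_eq Nx := coset_repr (coset (N P) x).
by have := nsV (nsJ x^-1 Nx); rewrite /conjg !invgM !invgK !mulgA mulgV mul1g.
Qed.

Fact quo_str_monoid P : monoid.monoid_morphism (@quo_str P).
Proof.
split=> [|p q].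
  by rewrite -[1%g in LHS]/(coset (N P) 1%g) quo_strE gmulf1.
rewrite -[p]coset_repr -[q]coset_repr -[(_ * _)%g in LHS]gmulfM.
by rewrite !quo_strE gmulfM.
Qed.

HB.instance Definition _ P := isUMagmaMorphism.Build _ _ (@quo_str P)
  (@quo_str_monoid P).

Definition quoOver P : groupOver Gamma :=
  @GroupOver _ (quo_group (N P)) (@quo_str P : UMagmaMorphism.type _ _).

Definition quo_proj P : homOver P (quoOver P) :=
  @HomOver _ P (quoOver P) (coset (N P) : UMagmaMorphism.type _ _) (@quo_strE P).

Definition quo_fun P G (f : homOver P G) : quo_group (N P) -> quo_group (N G) :=
  quo_group_map (@nf_map _ N P G f).

Fact quo_fun_str P G (f : homOver P G) q : quo_str (quo_fun f q) = quo_str q.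
Proof.
by rewrite -[q]coset_repr /quo_fun quo_group_mapE !quo_strE ho_str.
Qed.

Definition quo_map P G (f : homOver P G) : homOver (quoOver P) (quoOver G) :=
  @HomOver _ (quoOver P) (quoOver G)
    (quo_group_map (@nf_map _ N P G f) : UMagmaMorphism.type _ _)
    (@quo_fun_str P G f).

Lemma quo_mapE P G (f : homOver P G) x :
  quo_map f (quo_proj P x) = quo_proj G (f x).
Proof. exact: quo_group_mapE. Qed.

End QuotientOver.

Section LocalDerivedStep.
Context (R : pzRingType) (Gamma : groupType) (T : homology_localization_triple R Gamma).
Context (N : normal_subfunctor Gamma).
Implicit Types P G : groupOver Gamma.

Definition ld_Lambda P : pzRingType := hl_L T (quoOver N (hl_E T P)).

(* Z[P / N(P)] -> R[P^ / N(P^)] -> L(P^ / N(P^)), where P^ = E(P) *)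
Definition ld_coef P : {rmorphism grpring int (quoOver N P) -> ld_Lambda P} :=
  gl_unit (hl_L T) (quoOver N (hl_E T P))
    \o grpring_map (intmul 1 : {rmorphism int -> R}) (quo_map N (lf_eta (hl_E T) P)).

Lemma ld_coef_of P q : ld_coef P (grpring_of int q) =
  gl_unit (hl_L T) _ (grpring_of R (quo_map N (lf_eta (hl_E T) P) q)).
Proof. by rewrite /ld_coef [LHS]/= grpring_map_of. Qed.

(* Z[P / N(P)] and L(P^ / N(P^)) as right Z[P]-modules. *)
Definition ld_quo_module P : rmod P :=
  rmod_of_ring (grpring_map idfun (quo_proj N P)).
Definition ld_module P : rmod P :=
  rmod_of_ring (ld_coef P \o grpring_map idfun (quo_proj N P)).

Lemma ld_moduleE P (a : ld_module P) g : rm_act a g = (a : ld_Lambda P) *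
  gl_unit (hl_L T) _ (grpring_of R (quo_proj N _ (lf_eta (hl_E T) P g))).
Proof.
rewrite -[LHS]/((a : ld_Lambda P) *
  ld_coef P (grpring_map idfun (quo_proj N P) (grpring_of int g))).
by rewrite grpring_map_of ld_coef_of quo_mapE.
Qed.

Fact ld_coef_act P (a : ld_quo_module P) g :
  ld_coef P (rm_act a g) = rm_act (ld_coef P a : ld_module P) g.
Proof. exact: (rmorphM (ld_coef P)). Qed.

Definition ld_coef_map P : rmod_map idfun (ld_quo_module P) (ld_module P) :=
  @RModMap _ _ idfun (ld_quo_module P) (ld_module P) (ld_coef P) (@ld_coef_act P).

Lemma ld_proj1 P x : N P x -> quo_proj N P x = 1%g.
Proof.
move=> Nx; rewrite -[RHS]/(coset (N P) 1%g); apply/coset_eq.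
by rewrite mulg1; exact: nsV.
Qed.

Fact ld_cycleP P x : N P x ->
  (<< 1 *g x >> : cx_V (bar_complex1 (ld_quo_module P))) \in
    @is_cycle (bar_complex1 (ld_quo_module P)).
Proof.
move=> Nx; rewrite inE [cx_out _ _]bar_d1U /= grpring_map_of ld_proj1 //.
by rewrite mulr1 subrr.
Qed.

(* The map N(P) -> N(P)/[N(P), N(P)] = H_1(P; Z[P / N(P)]): the standard
   identification sends the class of x to that of the bar cycle 1 [x]. *)
Definition ld_to_H1 P x (Nx : N P x) : H1 (ld_quo_module P) :=
  hclass (Cycle (ld_cycleP Nx)).

(* The kernel of N(P) -> H_1(P; Z[P / N(P)]) -> H_1(P; L(P^ / N(P^))). *)
Definition ld_next_set P (x : P) : Prop :=
  exists Nx : N P x,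
    @H1_map P P (idfun : UMagmaMorphism.type P P) _ _ (ld_coef_map P)
      (ld_to_H1 Nx) = 0.

Lemma ld_next_setP P x :
  ld_next_set x <->
  N P x /\ exists c, @bar_d2 P (ld_module P) c = << (1 : ld_Lambda P) *g x >>.
Proof.
have E Nx : @H1_map P P (idfun : UMagmaMorphism.type P P) _ _ (ld_coef_map P)
      (@ld_to_H1 P x Nx) = 0 <->
    exists c, @bar_d2 P (ld_module P) c = << (1 : ld_Lambda P) *g x >>.
  rewrite /H1_map /ld_to_H1 homology_mapE.
  have -> : 0 = hclass (0 : cycles (bar_complex1 (ld_module P))) by rewrite /hclass raddf0.
  rewrite hclass_eq subr0 -(rmorph1 (ld_coef P)).
  by rewrite -(malg_mapU idfun (ld_coef_map P)).
split=> [[Nx /E xE]|[Nx /(E Nx) xE]]; [by split | by exists Nx].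
Qed.

Let act1 P x (a : ld_module P) : N P x -> rm_act a x = a.
Proof.
move=> Nx; rewrite -[LHS]/((a : ld_Lambda P) *
  ld_coef P (grpring_map idfun (quo_proj N P) (grpring_of int x))).
by rewrite grpring_map_of ld_proj1 // grpring_of1 (rmorph1 (ld_coef P)) mulr1.
Qed.

Fact ld_next1 P : ld_next_set (1%g : P).
Proof.
apply/ld_next_setP; split; first exact: ns1.
exists << (1 : ld_module P) *g (1%g, 1%g) >>.
by rewrite bar_d2U act1 ?mulg1 ?subrr ?add0r //; exact: ns1.
Qed.

Fact ld_nextM P x y :
  ld_next_set x -> ld_next_set y -> @ld_next_set P (x * y)%g.
Proof.
move=> /ld_next_setP[Nx [c cE]] /ld_next_setP[Ny [d dE]]; apply/ld_next_setP.
split; first exact: nsM.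
exists (c + d - << (1 : ld_module P) *g (x, y) >>).
rewrite raddfB raddfD /= cE dE bar_d2U act1 // !opprD !opprK.
by rewrite (AC (2*3) ((1*5)*(2*3)*4)) /= !subrr !add0r.
Qed.

Fact ld_nextV P x : ld_next_set x -> @ld_next_set P x^-1%g.
Proof.
move=> /ld_next_setP[Nx [c cE]]; have /ld_next_setP[_ [e eE]] := ld_next1 P.
apply/ld_next_setP; split; first exact: nsV.
exists (<< (1 : ld_module P) *g (x, x^-1%g) >> - c + e).
rewrite raddfD raddfB /= cE eE bar_d2U act1 // mulgV.
by rewrite addrK subrK.
Qed.

Fact ld_nextJ P x y : ld_next_set x -> @ld_next_set P (x ^ y)%g.
Proof.
move=> /ld_next_setP[Nx [c cE]]; apply/ld_next_setP; split; first exact: nsJ.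
pose rho : {rmorphism _ -> ld_Lambda P} := ld_coef P \o grpring_map idfun (quo_proj N P).
pose u g := rho (grpring_of int g).
pose w : {additive ld_Lambda P -> ld_Lambda P} := u y^-1%g \*o idfun.
have wA (a : ld_module P) g : w (rm_act a g) = rm_act (w a : ld_module P) g.
  by rewrite /w /= mulrA.
pose W := @RModMap _ _ idfun (ld_module P) (ld_module P) w wA.
pose e : {malg (ld_module P)[(P * P)%type]} :=
  << (1 : ld_module P) *g (y, (x ^ y)%g) >>
  - << (1 : ld_module P) *g (x, y) >> + c.
have eE : bar_d2 e = << (u y : ld_module P) *g (x ^ y)%g >>.
  rewrite raddfD raddfB /= cE !bar_d2U (act1 (1 : ld_module P) Nx) /conjg mulVKg.
  rewrite -[rm_act _ y]/(1 * u y) mul1r.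
  rewrite !opprD !opprK (AC (3*3*1) (1*(2*5)*(3*4)*(6*7))) /=.
  by rewrite !(subrr, addNr) !addr0.
have := bar_map_d2 (f := (idfun : UMagmaMorphism.type P P)) W e.
rewrite eE malg_mapU /= /u -rmorphM -grpring_ofM mulVg grpring_of1 rmorph1.
by move=> ->; eexists.
Qed.

Definition ld_next_sub P : normal_subgroup P :=
  NormalSubgroup (@ld_next1 P) (@ld_nextM P) (@ld_nextV P) (@ld_nextJ P).

Fact ld_next_ker P x : ld_next_sub P x -> go_str P x = 1%g.
Proof. by case=> Nx _; exact: nf_ker Nx. Qed.

Fact ld_next_map P G (f : homOver P G) x : ld_next_sub P x -> ld_next_sub G (f x).
Proof.
move=> /ld_next_setP[Nx [c cE]]; apply/ld_next_setP; split; first exact: nf_map.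
pose phi : {additive ld_module P -> ld_module G} :=
  gl_map (hl_L T) (quo_map N (ef_map (hl_E T) f)).
have phiA (a : ld_module P) g : phi (rm_act a g) = rm_act (phi a) (f g).
  rewrite !ld_moduleE [LHS](rmorphM (gl_map _ _)); congr (_ * _).
  rewrite gl_natural grpring_map_of quo_mapE.
  by rewrite -[lf_eta _ _ (f g)]/(homOver_comp _ _ g) lf_eta_natural.
have := bar_map_d2 (RModMap phiA) c.
rewrite cE malg_mapU /= rmorph1 => ->; by eexists.
Qed.

Definition ld_next : normal_subfunctor Gamma :=
  NormalSubfunctor ld_next_ker ld_next_map.

End LocalDerivedStep.

Section Transfinite.
Context (Gamma : groupType).

Fact ker_sub1 (P : groupOver Gamma) : go_str P 1%g = 1%g.
Proof. exact: gmulf1. Qed.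
Fact ker_subM (P : groupOver Gamma) x y :
  go_str P x = 1%g -> go_str P y = 1%g -> go_str P (x * y)%g = 1%g.
Proof. by rewrite gmulfM => -> ->; rewrite mulg1. Qed.
Fact ker_subV (P : groupOver Gamma) x : go_str P x = 1%g -> go_str P x^-1%g = 1%g.
Proof. by rewrite gmulfV => ->; rewrite invg1. Qed.
Fact ker_subJ (P : groupOver Gamma) x y : go_str P x = 1%g -> go_str P (x ^ y)%g = 1%g.
Proof. by rewrite gmulfJ => ->; rewrite conj1g. Qed.
Fact ker_sub_map (P G : groupOver Gamma) (f : homOver P G) x :
  go_str P x = 1%g -> go_str G (f x) = 1%g.
Proof. by rewrite ho_str. Qed.

(* P |-> ker (P -> Gamma) *)
Definition nf_kernel : normal_subfunctor Gamma :=
  @NormalSubfunctor _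
    (fun P => NormalSubgroup (ker_sub1 P) (@ker_subM P) (@ker_subV P) (@ker_subJ P))
    (fun P x h => h) ker_sub_map.

Section Intersection.
Context (I : Type) (i0 : I) (N : I -> normal_subfunctor Gamma).

Implicit Types P G : groupOver Gamma.

Definition nf_cap_set P (x : P) : Prop := forall i, N i P x.

Fact nf_cap1 P : @nf_cap_set P 1%g.
Proof. by move=> i; exact: ns1. Qed.
Fact nf_capM P x y : nf_cap_set x -> nf_cap_set y -> @nf_cap_set P (x * y)%g.
Proof. by move=> Nx Ny i; exact: nsM (Nx i) (Ny i). Qed.
Fact nf_capV P x : nf_cap_set x -> @nf_cap_set P x^-1%g.
Proof. by move=> Nx i; exact: nsV (Nx i). Qed.
Fact nf_capJ P x y : nf_cap_set x -> @nf_cap_set P (x ^ y)%g.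
Proof. by move=> Nx i; exact: nsJ (Nx i). Qed.
Fact nf_cap_ker P x : @nf_cap_set P x -> go_str P x = 1%g.
Proof. by move=> /(_ i0); exact: nf_ker. Qed.
Fact nf_cap_map P G (f : homOver P G) x : nf_cap_set x -> nf_cap_set (f x).
Proof. by move=> Nx i; exact: nf_map (Nx i). Qed.

Definition nf_cap : normal_subfunctor Gamma :=
  @NormalSubfunctor _
    (fun P => NormalSubgroup (@nf_cap1 P) (@nf_capM P) (@nf_capV P) (@nf_capJ P))
    nf_cap_ker nf_cap_map.

End Intersection.
End Transfinite.

Section WellOrder.
Context (W : Type) (le : rel W) (le_wo : well_order le).

Definition wo_lt (m n : W) : Prop := ~~ le n m.

Lemma wo_lt_wf : well_founded wo_lt.
Proof.
move=> n; apply: contrapT => nA.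
have [|m [[/asboolP mA min] _]] := le_wo (A := [pred x | `[< ~ Acc wo_lt x >]]).
  by exists n; apply/asboolP.
apply: mA; constructor=> k /negP km; apply: contrapT => kA.
by apply: km; apply: min; apply/asboolP.
Qed.

Definition wo_succ (m n : W) : Prop :=
  wo_lt m n /\ forall k, wo_lt k n -> le k m.

Lemma wo_succ_inj m m' n : wo_succ m n -> wo_succ m' n -> m = m'.
Proof.
move=> [mn mU] [m'n m'U].
have [|z [_ zU]] := le_wo (A := [pred x | `[< x = m \/ x = m' >]]).
  by exists m; apply/asboolP; left.
have zm : z = m.
  by apply: zU; split=> [|x /asboolP[]->]; [apply/asboolP; left | exact: mU | exact: m'U].
have zm' : z = m'.
  by apply: zU; split=> [|x /asboolP[]->]; [apply/asboolP; right | exact: mU | exact: m'U].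
by rewrite -zm -zm'.
Qed.

End WellOrder.

Section LocalDerivedSeries.
Context (R : pzRingType) (Gamma : groupType) (T : homology_localization_triple R Gamma).
Context (W : Type) (le : rel W) (le_wo : well_order le).

Definition ld_step (n : W) (D : forall k, wo_lt le k n -> normal_subfunctor Gamma) :
    normal_subfunctor Gamma :=
  match pselect (exists m, wo_succ le m n) with
  | left n_succ => let (m, mn) := cid n_succ in ld_next T (D m mn.1)
  | right _ =>
    match pselect (exists k, wo_lt le k n) with
    | left n_pos => let (k, kn) := cid n_pos in
      nf_cap (exist _ k kn) (fun i : {k | wo_lt le k n} => D (sval i) (svalP i))
    | right _ => nf_kernel Gamma
    end
  end.

(* An ordinal is given as an element n of a well-ordered set (W, le), namely
   the order type of the elements below n; the subgroup P^(n) of P is then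
   [local_derived n P], simultaneously for all P. *)
Definition local_derived : W -> normal_subfunctor Gamma :=
  Fix (wo_lt_wf le_wo) (fun=> normal_subfunctor Gamma) (@ld_step).

Lemma local_derivedE n : local_derived n = @ld_step n (fun k _ => local_derived k).
Proof.
apply: Fix_eq => m f g fg; congr (@ld_step m _).
by apply: functional_extensionality_dep => k; apply: functional_extensionality_dep => km; exact: fg.
Qed.

Lemma local_derived0 n : (forall k, ~ wo_lt le k n) ->
  local_derived n = nf_kernel Gamma.
Proof.
move=> n0; rewrite local_derivedE /ld_step.
case: (pselect (exists m, wo_succ le m n)) => [sm|_].
  by exfalso; have [m [mn _]] := sm; exact: (n0 m).
by case: (pselect (exists k, wo_lt le k n)) => // lk; exfalso; have [k kn] := lk; exact: (n0 k).
Qed.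

Lemma local_derivedS m n : wo_succ le m n ->
  local_derived n = ld_next T (local_derived m).
Proof.
move=> mn; rewrite local_derivedE /ld_step.
case: (pselect (exists m, wo_succ le m n)) => [n_succ|]; last by case; exists m.
by case: cid => m' m'n; rewrite (wo_succ_inj le_wo m'n mn).
Qed.

Lemma local_derivedL n : (exists k, wo_lt le k n) ->
  ~ (exists m, wo_succ le m n) ->
  forall P x, local_derived n P x <-> forall k, wo_lt le k n -> local_derived k P x.
Proof.
move=> n_pos n_lim P x; rewrite local_derivedE /ld_step.
case: (pselect (exists m, wo_succ le m n)) => // _.
case: (pselect (exists k, wo_lt le k n)) => // n_pos'; case: cid => k0 kn0.
by split=> [h k kn|h [k kn]]; [exact: (h (exist _ k kn)) | exact: h].
Qed.

End LocalDerivedSeries.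

(* R is (isomorphic to) Z/dZ with d > 0, or a subring of Q. *)
Definition coefficient_ring (R : comPzRingType) : Prop :=
  (exists2 d : nat, (0 < d)%N &
     (forall r : R, exists m : int, r = m%:~R) /\
     (forall m : int, (m%:~R == 0 :> R) = (d %| m)%Z))
  \/ (exists f : {rmorphism R -> rat}, injective f).

(* Main.v *)
Require Import Defs.
From HB Require Import structures.
From mathcomp Require Import all_boot all_order all_algebra.
From mathcomp Require Import boolp wochoice monalg.

(* As E P is local, any f : P -> G in Omega is a factor of eta : P -> E P, so it
   suffices to show, by induction on n, that eta reflects the n-th terms. In the
   successor step this follows from the injectivity of H_1(P; M) -> H_1(E P; M)
   for M = L(E P / N (E P)), an algebra over L(E P). The axioms give
   H_1(P; L) = H_1(E P; L) for L = L(E P) only, and passing from L to M also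
   requires the injectivity of H_0(P; L) -> H_0(E P; L), which is not an axiom: it
   comes from applying the axioms to the semidirect product of E P by H_0(P; L). *)

Set Implicit Arguments.
Unset Strict Implicit.
Unset Printing Implicit Defensive.

Import GRing.Theory.
Local Open Scope ring_scope.
Local Open Scope quotient_scope.

(** * Linear maps of chains and their base change along a ring map *)

Section LinearCombination.
Context (L M : pzRingType) (phi : {rmorphism L -> M}) (K J : choiceType).

Lemma malg_map_scaleB (a b : M) (y : {malg L[J]}) :
  malg_map id ((a - b) \*o phi) y = malg_map id (a \*o phi) y - malg_map id (b \*o phi) y.
Proof.
move: y; apply: (malg_ext (f := malg_map id ((a - b) \*o phi))
  (g := fun y => malg_map id (a \*o phi) y - malg_map id (b \*o phi) y)).
- exact: raddfB.
- by move=> c d /=; rewrite !raddfB /= addrACA.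
by move=> c k; rewrite !malg_mapU /= mulrBl raddfB.
Qed.

(** The left [M]-linear map with matrix [phi (s k)]. Bar differentials over a ring are left linear,
    as the group acts on the right, so chain maps given on generators over [L] extend to [M] in this
    form. *)
Definition malg_lin (s : K -> {malg L[J]}) (z : {malg M[K]}) : {malg M[J]} :=
  mlift (fun k m => malg_map id (m \*o phi) (s k)) z.

Context (s : K -> {malg L[J]}).

Fact malg_lin_is_zmod_morphism : zmod_morphism (malg_lin s).
Proof. by apply: mlift_is_zmod_morphism => k a b; exact: malg_map_scaleB. Qed.

HB.instance Definition _ := GRing.isZmodMorphism.Build _ _ (malg_lin s)
  malg_lin_is_zmod_morphism.

Lemma malg_linU m k : malg_lin s << m *g k >> = malg_map id (m \*o phi) (s k).
Proof. by rewrite /malg_lin mliftU // => l a b; exact: malg_map_scaleB. Qed.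

End LinearCombination.

(** Base change respects composition of linear maps; this carries identities checked on generators
    over [L] to [M]. *)
Lemma malg_map_lin (L M : pzRingType) (phi : {rmorphism L -> M}) (K J : choiceType)
    (s : K -> {malg L[J]}) (m : M) (y : {malg L[K]}) :
  malg_map id (m \*o phi) (malg_lin idfun s y) =
  malg_lin phi s (malg_map id (m \*o phi) y).
Proof.
move: y; apply: (malg_ext (f := fun y => malg_map id (m \*o phi) (malg_lin idfun s y))
  (g := fun y => malg_lin phi s (malg_map id (m \*o phi) y))).
- by move=> c d; rewrite !raddfB.
- by move=> c d; rewrite !raddfB.
move=> a k; rewrite malg_mapU !malg_linU; move: (s k) => {k}.
apply: (malg_ext (f := fun y => malg_map id (m \*o phi) (malg_map id (a \*o idfun) y))
  (g := malg_map id (((m \*o phi) a) \*o phi))).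
- by move=> c d; rewrite !raddfB.
- exact: raddfB.
by move=> b k; rewrite !malg_mapU /= rmorphM mulrA.
Qed.

(** * Injectivity and surjectivity on homology in terms of chains *)

Section HomologyChains.
Context (C D : complex) (f : complex_map C D).

Lemma homology_map_inj_chain : injective (homology_map f) ->
  forall v u, cx_out C v = 0 -> cm_V f v = cx_in D u -> exists w, cx_in C w = v.
Proof.
move=> f_inj v u vz vu.
have vC : v \in @is_cycle C by rewrite inE vz.
have zC : (0 : cx_V C) \in @is_cycle C by rewrite inE raddf0.
have /hclass_eq[w wE] : hclass (Cycle vC) = hclass (Cycle zC).
  by apply: f_inj; rewrite !homology_mapE; apply/hclass_eq; exists u; rewrite /= raddf0 subr0.
by exists w; rewrite wE /= subr0.
Qed.

Lemma homology_map_surj_chain : (forall y, exists x, homology_map f x = y) ->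
  forall v, cx_out D v = 0 -> exists2 z, cx_out C z = 0 &
    exists u, cx_in D u = v - cm_V f z.
Proof.
move=> f_surj v vz.
have vC : v \in @is_cycle D by rewrite inE vz.
have [] := f_surj (hclass (Cycle vC)); elim/quotW=> -[z zC].
rewrite -[\pi _]/(hclass _) homology_mapE => /esym/hclass_eq[u uE].
by exists z; [move: (zC); rewrite inE => /eqP | exists u].
Qed.

End HomologyChains.

(** * Change of coefficients in the bar complex *)

Lemma malg_map_idC (K J : choiceType) (V W : zmodType) (f : K -> J)
    (g : {additive V -> W}) (y : {malg V[K]}) :
  malg_map f idfun (malg_map id g y) = malg_map id g (malg_map f idfun y).
Proof.
move: y; apply: (malg_ext (f := fun y => malg_map f idfun (malg_map id g y))
  (g := fun y => malg_map id g (malg_map f idfun y))) => [c d|c d|a k].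
- by rewrite !raddfB.
- by rewrite !raddfB.
by rewrite !malg_mapU.
Qed.

(** Agreement on group elements is enough: the action in [rmod_of_ring] sees a ring map only through
    them. *)
Definition rho_compat (G : groupType) (L M : pzRingType) (phi : L -> M)
    (rho : grpring int G -> L) (sigma : grpring int G -> M) :=
  forall g, phi (rho (grpring_of int g)) = sigma (grpring_of int g).

Lemma rho_compat_refl (G : groupType) (L : pzRingType) (rho : grpring int G -> L) :
  rho_compat (idfun : {rmorphism L -> L}) rho rho.
Proof. by []. Qed.

Section ScaleMap.
Context (G : groupType) (L M : pzRingType) (phi : {rmorphism L -> M}).
Context (rho : {rmorphism grpring int G -> L}) (sigma : {rmorphism grpring int G -> M}).
Context (rho_sigma : rho_compat phi rho sigma).

(** Left multiplication commutes with the group action, which is by right multiplication. *)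
Fact scale_act (m : M) (a : rmod_of_ring rho) g :
  (m \*o phi) (rm_act a g) = rm_act ((m \*o phi) a : rmod_of_ring sigma) g.
Proof. by rewrite [LHS]/= rmorphM rho_sigma mulrA. Qed.

Definition scale_map (m : M) : rmod_map idfun (rmod_of_ring rho) (rmod_of_ring sigma) :=
  @RModMap _ _ idfun (rmod_of_ring rho) (rmod_of_ring sigma) _ (scale_act m).

Fact scale_res_act (H : groupType) (f : UMagmaMorphism.type H G) (m : M)
    (a : rmod_res f (rmod_of_ring rho)) g :
  (m \*o phi) (rm_act a g) = rm_act ((m \*o phi) a : rmod_res f (rmod_of_ring sigma)) g.
Proof. exact: scale_act. Qed.

Definition scale_res_map (H : groupType) (f : UMagmaMorphism.type H G) (m : M) :
    rmod_map idfun (rmod_res f (rmod_of_ring rho)) (rmod_res f (rmod_of_ring sigma)) :=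
  @RModMap _ _ idfun (rmod_res f (rmod_of_ring rho)) (rmod_res f (rmod_of_ring sigma))
    (m \*o phi) (@scale_res_act H f m).

End ScaleMap.

(** The map on pairs in [bar_map_d2] is [(p.1, p.2)], which equals [id] only after a case
    analysis. *)
Lemma bar_map_d2_id (G : groupType) (A B : rmod G) (phi : rmod_map idfun A B) c :
  malg_map id phi (bar_d2 c) = bar_d2 (malg_map id phi c).
Proof.
have := bar_map_d2 (f := (idfun : UMagmaMorphism.type G G)) phi c => ->.
by congr (bar_d2 (malg_map _ _ _)); apply/funext => -[].
Qed.

Lemma bar_d2_single_map (G : groupType) (A B : rmod G) (phi : rmod_map idfun A B) a b x :
  phi a = b -> (exists c, bar_d2 (A := A) c = << a *g x >>) ->
  exists c, bar_d2 (A := B) c = << b *g x >>.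
Proof.
move=> <- [c cE]; exists (malg_map id phi c).
by rewrite -bar_map_d2_id cE malg_mapU.
Qed.

Lemma bar_d2_diff_map (G : groupType) (A B : rmod G) (phi : rmod_map idfun A B) a b x y :
  phi a = b -> (exists c, bar_d2 (A := A) c = << a *g x >> - << a *g y >>) ->
  exists c, bar_d2 (A := B) c = << b *g x >> - << b *g y >>.
Proof.
move=> <- [c cE]; exists (malg_map id phi c).
by rewrite -bar_map_d2_id cE raddfB /= !malg_mapU.
Qed.

Lemma H1_map_inj_chain (P B : groupType) (f : UMagmaMorphism.type P B) (A : rmod B) :
  injective (H1_map (rmod_res_map f A)) ->
  forall y u, bar_d1 (A := rmod_res f A) y = 0 -> malg_map f idfun y = bar_d2 (A := A) u ->
  exists v, bar_d2 (A := rmod_res f A) v = y.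
Proof.
move=> f_inj y u y0 yu.
by have [v <-] := homology_map_inj_chain (f := bar_map1 (rmod_res_map f A)) f_inj y0 yu;
  exists v.
Qed.

(** The chain [a[x] - a[y]] is a cycle, since [x] and [y] act alike through [f], and [f] sends it to
    0. *)
Lemma H1_map_inj_congr (P B : groupType) (f : UMagmaMorphism.type P B) (A : rmod B)
    (a : A) x y :
  injective (H1_map (rmod_res_map f A)) -> f x = f y ->
  exists c, bar_d2 (A := rmod_res f A) c = << a *g x >> - << a *g y >>.
Proof.
move=> f_inj fxy; apply: (H1_map_inj_chain f_inj (u := 0)).
  rewrite raddfB /= !bar_d1U.
  have -> : rm_act (a : rmod_res f A) x = rm_act (a : rmod_res f A) y.
    exact: (congr1 (rm_act (r := A) a) fxy).
  exact: subrr.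
by rewrite raddfB raddf0 /= !malg_mapU /= fxy subrr.
Qed.

(** * Base change for injectivity on H_1 *)

Section BaseChange.
Context (P B : groupType) (f : UMagmaMorphism.type P B).
Context (L M : pzRingType) (phi : {rmorphism L -> M}).
Context (rho : {rmorphism grpring int B -> L}) (sigma : {rmorphism grpring int B -> M}).
Context (rho_sigma : rho_compat phi rho sigma).
Let A : rmod B := rmod_of_ring rho.
Let C : rmod B := rmod_of_ring sigma.

Context (H1_bij : bijective (H1_map (rmod_res_map f A))).
(** By left linearity this is the injectivity of H_0(P; L) -> H_0(B; L), tested on generators of the
    kernel. *)
Context (H0_inj : forall b : B,
  exists c, bar_d1 (A := rmod_res f A) c = rm_act (1 : A) b - 1).

(** [H0_inj] gives a chain [c] with the boundary of [1[b]]. By surjectivity on H_1 the cycle [1[b] -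
    f c] is homologous to the image of a cycle of [P], which is added to [c]. *)
Let chain_lift b : exists c, bar_d1 (A := rmod_res f A) c = rm_act (1 : A) b - 1 /\
  exists u, bar_d2 (A := A) u = << (1 : A) *g b >> - malg_map f idfun c.
Proof.
have [c cE] := H0_inj b.
have [||z z0 [u uE]] := @homology_map_surj_chain _ _ (bar_map1 (rmod_res_map f A)) _
  (<< (1 : A) *g b >> - malg_map f idfun c).
- by case: H1_bij => g _ gK y; exists (g y); exact: gK.
- rewrite [LHS]raddfB /= bar_d1U.
  by have /= <- := bar_map_d1 (rmod_res_map f A) c; rewrite cE subrr.
exists (c + z); split; first by rewrite raddfD /= cE [X in _ + X]z0 addr0.
by exists u; rewrite raddfD /= opprD addrA -uE.
Qed.

(* The L-linear maps s : C_1(B) -> C_1(P) and t : C_2(B) -> C_2(P) commute with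
   the differentials and h is a homotopy from s o f to the identity on C_1(P),
   so they survive the change of coefficients to M. *)
Lemma H1_base_change (z : {malg M[P]}) w :
  bar_d2 (A := C) w = malg_map f idfun z ->
  exists v, bar_d2 (A := rmod_res f C) v = z.
Proof.
move=> wE; have [s sP] := choice chain_lift; have [k kE] := choice (fun b => (sP b).2).
have d1s (y : {malg L[B]}) :
    bar_d1 (A := rmod_res f A) (malg_lin idfun s y) = bar_d1 (A := A) y.
  move: y; apply: (malg_ext
    (f := fun y => bar_d1 (A := rmod_res f A) (malg_lin idfun s y))
    (g := bar_d1 (A := A))).
  - by move=> c d; rewrite !raddfB.
  - exact: (@bar_d1_is_zmod_morphism B A).
  move=> a b; rewrite malg_linU.
  have /= <- := bar_map_d1 (f := (idfun : UMagmaMorphism.type P P))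
    (scale_res_map (rho_compat_refl rho) f a) (s b).
  by rewrite (sP b).1 bar_d1U /= mulrBr mulr1 mul1r.
have fs (y : {malg L[B]}) :
    malg_map f idfun (malg_lin idfun s y) = y - bar_d2 (A := A) (malg_lin idfun k y).
  move: y; apply: (malg_ext (f := fun y => malg_map f idfun (malg_lin idfun s y))
    (g := fun y => y - bar_d2 (A := A) (malg_lin idfun k y))).
  - by move=> c d; rewrite !raddfB.
  - by move=> c d /=; rewrite !raddfB /= addrACA.
  move=> a b; rewrite !malg_linU.
  have /= <- := bar_map_d2_id (scale_map (rho_compat_refl rho) a) (k b).
  rewrite kE raddfB /= malg_mapU /= mulr1 opprB addrC subrK.
  exact: malg_map_idC.
(* [s] of a boundary is a cycle of [P] whose image bounds in [B], by [fs]; injectivity on H_1 makes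
   it bound in [P]. *)
have bd_lift (p : B * B) : exists v, bar_d2 (A := rmod_res f A) v =
    malg_lin idfun s (bar_d2 (A := A) << (1 : A) *g p >>).
  apply: (H1_map_inj_chain (bij_inj H1_bij) (u := << (1 : A) *g p >> -
    malg_lin idfun k (bar_d2 (A := A) << (1 : A) *g p >>))).
    by rewrite d1s bar_d1_d2.
  by rewrite fs raddfB.
have [t tE] := choice bd_lift.
(* The same argument: the image of [[x] - s (f x)] is the boundary of [k (f x)]. *)
have homot x : exists h, bar_d2 (A := rmod_res f A) h = << (1 : A) *g x >> - s (f x).
  apply: (H1_map_inj_chain (bij_inj H1_bij) (u := k (f x))).
    by rewrite raddfB /= bar_d1U (sP _).1 subrr.
  by rewrite kE raddfB /= malg_mapU.
have [h hE] := choice homot.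
have d2t (y : {malg M[(B * B)%type]}) :
    bar_d2 (A := rmod_res f C) (malg_lin phi t y) = malg_lin phi s (bar_d2 (A := C) y).
  move: y; apply: (malg_ext (f := fun y => bar_d2 (A := rmod_res f C) (malg_lin phi t y))
    (g := fun y => malg_lin phi s (bar_d2 (A := C) y))).
  - by move=> c d; rewrite !raddfB.
  - by move=> c d; rewrite !raddfB.
  move=> m p; rewrite malg_linU.
  have /= <- := bar_map_d2_id (scale_res_map rho_sigma f m) (t p).
  rewrite tE malg_map_lin; congr (malg_lin _ _ _).
  have /= -> := bar_map_d2_id (scale_map rho_sigma m) << (1 : A) *g p >>.
  by rewrite malg_mapU /= rmorph1 mulr1.
have d2h (y : {malg M[P]}) : bar_d2 (A := rmod_res f C) (malg_lin phi h y) =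
    y - malg_lin phi s (malg_map f idfun y).
  move: y; apply: (malg_ext (f := fun y => bar_d2 (A := rmod_res f C) (malg_lin phi h y))
    (g := fun y => y - malg_lin phi s (malg_map f idfun y))).
  - by move=> c d; rewrite !raddfB.
  - by move=> c d /=; rewrite !raddfB /= addrACA.
  move=> m x; rewrite malg_mapU !malg_linU.
  have /= <- := bar_map_d2_id (scale_res_map rho_sigma f m) (h x).
  by rewrite hE raddfB /= malg_mapU /= rmorph1 mulr1.
(* The boundary is [s (d2 w) + z - s (f z)], and [d2 w = f z]. *)
exists (malg_lin phi t w + malg_lin phi h z).
by rewrite raddfD /= d2t d2h wE addrC subrK.
Qed.

End BaseChange.

(** * The semidirect product of a group by a left module *)

Section Semidirect.
Context (G : groupType) (L : pzRingType) (rho : {rmorphism grpring int G -> L}).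
Context (N : lmodType L).

(* [rho] is a phantom argument, on which the group law below depends. *)
Definition semidirect (_ : {rmorphism grpring int G -> L}) : Type := (N * G)%type.
Local Notation S := (semidirect rho).

HB.instance Definition _ := Choice.copy S (N * G)%type.

Implicit Types x y z : S.

Definition sd_mul x y : S := (x.1 + rho (grpring_of int x.2) *: y.1, (x.2 * y.2)%g).
Definition sd_one : S := (0, 1%g).
Definition sd_inv x : S := (- (rho (grpring_of int x.2^-1%g) *: x.1), x.2^-1%g).

Fact sd_mulA : associative sd_mul.
Proof.
move=> x y z; rewrite /sd_mul /= mulgA grpring_ofM rmorphM.
by rewrite scalerDr scalerA addrA.
Qed.

Fact sd_mul1x : left_id sd_one sd_mul.
Proof. by case=> n g; rewrite /sd_mul /= mul1g grpring_of1 rmorph1 scale1r add0r. Qed.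

Fact sd_mulx1 : right_id sd_one sd_mul.
Proof. by case=> n g; rewrite /sd_mul /= mulg1 scaler0 addr0. Qed.

Fact sd_mulVx : left_inverse sd_one sd_inv sd_mul.
Proof. by case=> n g; rewrite /sd_mul /= mulVg addNr. Qed.

Fact sd_mulxV : right_inverse sd_one sd_inv sd_mul.
Proof.
case=> n g; rewrite /sd_mul /= mulgV scalerN scalerA -rmorphM -grpring_ofM.
by rewrite mulgV grpring_of1 rmorph1 scale1r subrr.
Qed.

HB.instance Definition _ := isGroup.Build S sd_mulA sd_mul1x sd_mulx1 sd_mulVx sd_mulxV.

Definition sd_proj (x : S) : G := x.2.
Fact sd_proj_monoid : monoid.monoid_morphism sd_proj.
Proof. by []. Qed.
HB.instance Definition _ := isUMagmaMorphism.Build S G sd_proj sd_proj_monoid.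

Definition sd_inj (g : G) : S := (0, g).
Fact sd_inj_monoid : monoid.monoid_morphism sd_inj.
Proof. by split=> // g h; congr pair; rewrite scaler0 addr0. Qed.
HB.instance Definition _ := isUMagmaMorphism.Build G S sd_inj sd_inj_monoid.

(* The conjugate of the section [sd_inj] by [(- n, 1)]. *)
Definition sd_conj (n : N) (g : G) : S := ((rho (grpring_of int g) - 1) *: n, g).
Fact sd_conj_monoid n : monoid.monoid_morphism (sd_conj n).
Proof.
split=> [|g h]; first by rewrite /sd_conj grpring_of1 rmorph1 subrr scale0r.
congr pair; rewrite scalerA -scalerDl grpring_ofM rmorphM; congr (_ *: _).
by rewrite mulrBr mulr1 [RHS]addrC subrKA.
Qed.
HB.instance Definition _ n := isUMagmaMorphism.Build G S (sd_conj n) (sd_conj_monoid n).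

(** The projection to [N] is a crossed homomorphism; this is its left linear extension to 1-chains,
    and the cocycle identity makes it vanish on boundaries. *)
Definition sd_functional (c : {malg L[S]}) : N := mlift (fun x a => a *: x.1) c.

Fact sd_functional_is_zmod_morphism : zmod_morphism sd_functional.
Proof. by apply: mlift_is_zmod_morphism => x a b; rewrite scalerBl. Qed.

HB.instance Definition _ := GRing.isZmodMorphism.Build _ _ sd_functional
  sd_functional_is_zmod_morphism.

Lemma sd_functionalU a x : sd_functional << a *g x >> = a *: x.1.
Proof. by rewrite /sd_functional mliftU // => k b c; rewrite scalerBl. Qed.

Lemma sd_functional_d2 c :
  sd_functional (bar_d2 (A := rmod_res sd_proj (rmod_of_ring rho)) c) = 0.
Proof.
move: c; apply: (malg_ext
  (f := fun c => sd_functional (bar_d2 (A := rmod_res sd_proj (rmod_of_ring rho)) c))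
  (g := fun=> 0)).
- by move=> c d; rewrite !raddfB.
- by move=> c d; rewrite subrr.
move=> a [x y]; rewrite bar_d2U raddfD raddfB /= !sd_functionalU /=.
rewrite scalerDr scalerA opprD [- _ - _]addrC addrA subrr add0r; exact: addNr.
Qed.

(** The functional kills the boundary and takes the right-hand side to [(rho g - 1) *: n]. *)
Lemma sd_boundary_fixed c n g :
  bar_d2 (A := rmod_res sd_proj (rmod_of_ring rho)) c =
    << (1 : L) *g sd_conj n g >> - << (1 : L) *g sd_inj g >> ->
  rho (grpring_of int g) *: n = n.
Proof.
move/(congr1 sd_functional); rewrite sd_functional_d2 raddfB /= !sd_functionalU !scale1r.
by rewrite subr0 [(sd_conj n g).1]scalerBl scale1r => /esym/subr0_eq.
Qed.

End Semidirect.

(** * H_0(P; L) as a left L-module *)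

Section Coinvariants.
Context (P B : groupType) (f : UMagmaMorphism.type P B).
Context (L : pzRingType) (rho : {rmorphism grpring int B -> L}).
Let A : rmod P := rmod_res f (rmod_of_ring rho).

Fact bar_complex0_out_in u : (\0 : {additive A -> A}) (bar_d1 (A := A) u) = 0.
Proof. by []. Qed.

(* Its homology is H_0(P; L), the quotient of L by the left ideal generated by
   the [rho (f p) - 1]. *)
Definition bar_complex0 : complex := Complex bar_complex0_out_in.

Definition coinv : Type := homology bar_complex0.
HB.instance Definition _ := GRing.Zmodule.on coinv.

Fact coinv_classP (a : L) : (a : cx_V bar_complex0) \in @is_cycle bar_complex0.
Proof. by rewrite inE. Qed.

Definition coinv_class (a : L) : coinv := hclass (Cycle (coinv_classP a)).

Lemma coinv_class_eq a b :
  coinv_class a = coinv_class b <-> exists c, bar_d1 (A := A) c = a - b.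
Proof. exact: hclass_eq. Qed.

Lemma coinv_classB : {morph coinv_class : a b / a - b}.
Proof. by move=> a b; rewrite -[RHS]hclassB; congr hclass; apply: val_inj. Qed.

Lemma coinv_ind (Q : coinv -> Prop) : (forall a, Q (coinv_class a)) -> forall n, Q n.
Proof.
move=> Qc; elim/quotW=> -[a aP]; rewrite -[\pi _]/(hclass _).
by have := Qc a; rewrite /coinv_class (Prop_irrelevance aP (coinv_classP a)).
Qed.

(** Left multiplication commutes with the right action of [P], so it descends to the
    coinvariants. *)
Fact coinv_scale_in (a : L) u :
  (a \*o idfun) (bar_d1 (A := A) u) = bar_d1 (A := A) (malg_map id (a \*o idfun) u).
Proof.
exact: (bar_map_d1 (f := (idfun : UMagmaMorphism.type P P))
  (scale_res_map (rho_compat_refl rho) f a)).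
Qed.

Fact coinv_scale_out (a : L) (v : A) :
  (a \*o idfun) (cx_out bar_complex0 v) = cx_out bar_complex0 ((a \*o idfun) v).
Proof. exact: mulr0. Qed.

Definition coinv_scale (a : L) : coinv -> coinv :=
  homology_map (@ComplexMap bar_complex0 bar_complex0 _ _ _
    (coinv_scale_in a) (coinv_scale_out a)).

Lemma coinv_scaleE a b : coinv_scale a (coinv_class b) = coinv_class (a * b).
Proof. by rewrite /coinv_scale homology_mapE; congr hclass; apply: val_inj. Qed.

Lemma coinv_classD : {morph coinv_class : a b / a + b}.
Proof.
move=> a b; have c0 : coinv_class 0 = 0 by rewrite -(subrr 0) coinv_classB subrr.
by rewrite -{1}[b]opprK coinv_classB -sub0r coinv_classB c0 sub0r opprK.
Qed.

Fact coinv_scaleA a b n : coinv_scale a (coinv_scale b n) = coinv_scale (a * b) n.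
Proof. by elim/coinv_ind: n => c; rewrite !coinv_scaleE mulrA. Qed.

Fact coinv_scale1 : left_id 1 coinv_scale.
Proof. by elim/coinv_ind=> c; rewrite coinv_scaleE mul1r. Qed.

Fact coinv_scaleDr : right_distributive coinv_scale +%R.
Proof. by move=> a m n; exact: raddfD. Qed.

Fact coinv_scaleDl n : {morph coinv_scale^~ n : a b / a + b}.
Proof.
by move=> a b; elim/coinv_ind: n => c; rewrite !coinv_scaleE mulrDl coinv_classD.
Qed.

HB.instance Definition _ := GRing.Zmodule_isLmodule.Build L coinv
  coinv_scaleA coinv_scale1 coinv_scaleDr coinv_scaleDl.

Lemma coinv_classZ a b : a *: coinv_class b = coinv_class (a * b).
Proof. exact: coinv_scaleE. Qed.

(** This makes the two sections of the semidirect product agree on the image of [P]. *)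
Lemma coinv_class_act p :
  coinv_class (rho (grpring_of int (f p))) = coinv_class 1.
Proof.
apply/coinv_class_eq; exists << (1 : A) *g p >>.
by rewrite bar_d1U -[rm_act _ _]/(1 * _) mul1r.
Qed.

End Coinvariants.

(** * Injectivity on H_0 and the successor step *)

Section Injectivity.
Context (R : pzRingType) (Gamma : groupType) (T : homology_localization_triple R Gamma).
Implicit Types P G : groupOver Gamma.

Lemma local_ext_uniq P G A (f : homOver P G) (u v : homOver G A) :
  is_local (hl_Omega T) A -> hl_Omega T f ->
  homOver_comp u f = homOver_comp v f -> u = v.
Proof.
move=> A_local f_in uv; have [w [_ w_uniq]] := A_local _ _ _ f_in (homOver_comp v f).
by rewrite -(w_uniq _ uv) -(w_uniq v).
Qed.

Lemma gl_map_act P G (f : homOver P G) (a : gl_module (hl_L T) P) x :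
  gl_map (hl_L T) f (rm_act a x) =
  rm_act (gl_map (hl_L T) f a : gl_module (hl_L T) G) (f x).
Proof.
rewrite [LHS](rmorphM (gl_map _ _)); congr (_ * _).
by rewrite [X in gl_map _ _ X]/= grpring_map_of gl_natural grpring_map_of /= grpring_map_of.
Qed.

(* Let D = H_0(P; L(E P)) >| E P. The sections sd_conj [1] and sd_inj of D -> E P
   agree on P, hence agree in the local group E D; since H_1(D; L(E D)) embeds in
   H_1(E D; L(E D)), the cycle sd_conj b - sd_inj b bounds, first over L(E D) and
   then over L(E P), where sd_functional sends it to (b - 1) [1]. *)
Lemma eta_H0_inj P (b : hl_E T P) : exists c,
  bar_d1 (A := rmod_res (lf_eta (hl_E T) P) (gl_module (hl_L T) (hl_E T P))) c =
  rm_act (1 : gl_module (hl_L T) (hl_E T P)) b - 1.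
Proof.
set eta := lf_eta (hl_E T) P.
pose rho : {rmorphism grpring int (hl_E T P) -> hl_L T (hl_E T P)} :=
  gl_unit (hl_L T) (hl_E T P) \o grpring_base R (hl_E T P).
pose N : lmodType _ := coinv eta rho.
pose n : N := coinv_class eta rho 1.
pose S := semidirect N rho.
pose D : groupOver Gamma := @GroupOver _ S
  (go_str (hl_E T P) \o @sd_proj _ _ rho N : UMagmaMorphism.type S Gamma).
pose q : homOver D (hl_E T P) := @HomOver _ D (hl_E T P)
  (@sd_proj _ _ rho N : UMagmaMorphism.type S _) (fun=> erefl).
pose s1 : homOver (hl_E T P) D := @HomOver _ (hl_E T P) D
  (sd_conj rho n : UMagmaMorphism.type _ S) (fun=> erefl).
pose s2 : homOver (hl_E T P) D := @HomOver _ (hl_E T P) D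
  (@sd_inj _ _ rho N : UMagmaMorphism.type _ S) (fun=> erefl).
have s12 : homOver_comp s1 eta = homOver_comp s2 eta.
  apply: homOver_eq => x; congr pair.
  by rewrite scalerBl scale1r coinv_classZ mulr1 coinv_class_act subrr.
pose eD := lf_eta (hl_E T) D.
have e12 : homOver_comp eD s1 = homOver_comp eD s2.
  apply: (local_ext_uniq (@lf_local _ _ (hl_E T) D) (hl_eta_in T P)).
  apply: homOver_eq => x; congr (eD _).
  exact: (congr1 (fun h : homOver P D => h x) s12).
have e12' x : eD (s1 x) = eD (s2 x) by exact: (congr1 (fun h : homOver _ _ => h x) e12).
(* As [E P] is local, [q] extends to [v : E D -> E P], which induces the change of coefficients L(E
   D) -> L(E P). *)
have [v [vq _]] := @lf_local _ _ (hl_E T) P _ _ _ (hl_eta_in T D) q.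
have [[g gK _] _] := hl_two_connected (hl_eta_in T D).
have s12_bd := H1_map_inj_congr (1 : gl_module (hl_L T) (hl_E T D)) (can_inj gK) (e12' b).
pose phi : {additive gl_module (hl_L T) (hl_E T D) -> gl_module (hl_L T) (hl_E T P)} :=
  gl_map (hl_L T) v.
have phiA (a : rmod_res eD (gl_module (hl_L T) (hl_E T D))) x :
  phi (rm_act a x) = rm_act (phi a : rmod_res (@sd_proj _ _ rho N) (rmod_of_ring rho)) x.
  by rewrite [LHS]gl_map_act; congr rm_act; exact: (congr1 (fun h : homOver D _ => h x) vq).
pose Phi := @RModMap D D idfun (rmod_res eD (gl_module (hl_L T) (hl_E T D)))
  (rmod_res (@sd_proj _ _ rho N) (rmod_of_ring rho)) phi phiA.
have [c cE] := bar_d2_diff_map (phi := Phi) (rmorph1 (gl_map (hl_L T) v)) s12_bd.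
have := sd_boundary_fixed cE.
rewrite coinv_classZ mulr1 => /coinv_class_eq[w wE].
by exists w; rewrite wE -[rm_act _ _]/(1 * _) mul1r.
Qed.


Context (N : normal_subfunctor Gamma).

Let sigma P : {rmorphism grpring int P -> hl_L T (quoOver N P)} :=
  gl_unit (hl_L T) (quoOver N P) \o grpring_map (intmul 1 : {rmorphism int -> R}) (quo_proj N P).

Let sigma_of P x :
  sigma P (grpring_of int x) = gl_unit (hl_L T) _ (grpring_of R (quo_proj N P x)).
Proof. by rewrite [LHS]/= grpring_map_of. Qed.

(** The hypothesis is a boundary in [E P] over L(E(E P) / N). It is moved to M = L(E P / N(E P)),
    and [H1_base_change] along L(E P) -> M brings it down to [P]. *)
Lemma ld_next_reflect P x :
  N P x -> ld_next T N (hl_E T P) (lf_eta (hl_E T) P x) -> ld_next T N P x.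
Proof.
move=> Nx /ld_next_setP[_ [c cE]]; apply/ld_next_setP; split=> //.
set eta := lf_eta (hl_E T) P in cE *.
(* Locality of [E P] extends its identity to a retraction [r : E (E P) -> E P]. *)
have [r [r_eta _]] := @lf_local _ _ (hl_E T) P _ _ _ (hl_eta_in T (hl_E T P)) (homOver_id _).
pose phi : {additive ld_module T N (hl_E T P) -> rmod_of_ring (sigma (hl_E T P))} :=
  gl_map (hl_L T) (quo_map N r).
have phiA (a : ld_module T N (hl_E T P)) g : phi (rm_act a g) = rm_act (phi a) g.
  rewrite ld_moduleE [LHS](rmorphM (gl_map _ _)); congr (_ * _).
  rewrite gl_natural grpring_map_of quo_mapE [RHS]sigma_of.
  by rewrite -[r _]/(homOver_comp r _ g) r_eta.
have [d dE] := bar_d2_single_map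
  (phi := @RModMap (hl_E T P) (hl_E T P) idfun _ (rmod_of_ring (sigma (hl_E T P))) phi phiA)
  (rmorph1 (gl_map (hl_L T) (quo_map N r))) (ex_intro _ c cE).
have compat : rho_compat (gl_map (hl_L T) (quo_proj N (hl_E T P)))
    (gl_unit (hl_L T) (hl_E T P) \o grpring_base R (hl_E T P)) (sigma (hl_E T P)).
  move=> g; rewrite sigma_of [X in gl_map _ _ X]/= grpring_map_of gl_natural.
  by rewrite grpring_map_of.
have [|v vE] := H1_base_change compat (hl_two_connected (hl_eta_in T P)).1
    (@eta_H0_inj P) (z := << 1 *g x >>) (w := d).
  by rewrite dE malg_mapU.
(* Both modules are M with [g] acting through [eta g]; only the presentations of the action
   differ. *)
pose psi : {additive rmod_res eta (rmod_of_ring (sigma (hl_E T P))) -> ld_module T N P} := idfun.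
have psiA (a : rmod_res eta (rmod_of_ring (sigma (hl_E T P)))) g :
    psi (rm_act a g) = rm_act (psi a) g.
  by rewrite ld_moduleE; congr (_ * _); exact: sigma_of.
exact: (bar_d2_single_map (phi := @RModMap P P idfun _ (ld_module T N P) psi psiA)
  erefl (ex_intro _ v vE)).
Qed.

End Injectivity.

(** * Transfinite induction and conclusion *)

Lemma local_derived_reflect (R : pzRingType) (Gamma : groupType)
    (T : homology_localization_triple R Gamma)
    (W : Type) (le : rel W) (le_wo : well_order le) (n : W) (P : groupOver Gamma) x :
  local_derived T le_wo n (hl_E T P) (lf_eta (hl_E T) P x) -> local_derived T le_wo n P x.
Proof.
elim/(well_founded_ind (wo_lt_wf le_wo)): n => n IH in P x *.
have [[m mn]|n_lim] := pselect (exists m, wo_succ le m n).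
  rewrite (local_derivedS T le_wo mn) => ex; apply: ld_next_reflect => //.
  (* Membership in [ld_next] contains membership in the term before, to which the induction
     hypothesis applies. *)
  by apply: IH; [exact: mn.1 | case: ex].
have [n_pos|n0] := pselect (exists k, wo_lt le k n).
  move=> /(local_derivedL T le_wo n_pos n_lim) ex.
  apply/(local_derivedL T le_wo n_pos n_lim) => k kn.
  by apply: IH => //; exact: ex.
rewrite local_derived0 => [|k kn]; last by apply: n0; exists k.
by rewrite /= ho_str.
Qed.

Lemma quo_map_inj (Gamma : groupType) (N : normal_subfunctor Gamma) (P G : groupOver Gamma)
    (f : homOver P G) : (forall x, N G (f x) -> N P x) -> injective (quo_map N f).
Proof.
move=> f_reflect p q; rewrite -[p]coset_repr -[q]coset_repr.
rewrite [LHS]quo_group_mapE [RHS]quo_group_mapE => /coset_eq.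
by rewrite -gmulfV -gmulfM => /f_reflect/coset_eq.
Qed.

Theorem theorem3p8 (R : comPzRingType) (R_coef : coefficient_ring R)
    (Gamma : groupType) (T : homology_localization_triple R Gamma)
    (W : Type) (le : rel W) (le_wo : well_order le) (n : W) :
  (forall (P G : groupOver Gamma) (f : homOver P G), hl_Omega T f ->
     injective (quo_map (local_derived T le_wo n) f)) /\
  (forall P : groupOver Gamma,
     injective (quo_map (local_derived T le_wo n) (lf_eta (hl_E T) P))).
Proof.
split=> [P G f f_in|P]; apply: quo_map_inj => x; last exact: local_derived_reflect.
(* [v : G -> E P] satisfies [v f = eta], and by naturality it maps the n-th term of [G] into that of
   [E P]. *)
have [v [vf _]] := @lf_local _ _ (hl_E T) P _ _ _ f_in (lf_eta (hl_E T) P).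
move=> /(nf_map v) vfx; apply: local_derived_reflect.
by rewrite -vf.
Qed.
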